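(* Let $n\geq 6$ be an integer and let $\mathbb{A}_n$ be the double antiprism graph, i.e. the simple graph with vertex set $V(\mathbb{A}_n)=\{j^{l}_{r} : 1\leq r\leq 3,\ 1\leq l\leq n\}$ ($3n$ distinct vertices) and edge set $$E(\mathbb{A}_n)=\{\, j^{l}_{r}j^{l+1}_{r},\ j^{l}_{1}j^{l}_{2},\ j^{l}_{2}j^{l}_{3},\ j^{l}_{2}j^{l+1}_{1},\ j^{l}_{3}j^{l+1}_{2} \ :\ 1\leq r\leq 3,\ 1\leq l\leq n \,\},$$ where superscripts are taken modulo $n$ (so $j^{n+1}_r=j^1_r$). Then the fault-tolerant metric dimension of $\mathbb{A}_n$ is $\mathrm{fdim}(\mathbb{A}_n)=4$.
   Context: Let $\Gamma=(V,E)$ be a non-trivial, undirected, simple, connected graph, and let $d(u,v)$ denote the length of a shortest $u$–$v$ path. For a set $R=\{u^1,\dots,u^t\}\subseteq V$ (ordered), the code of a vertex $u$ with respect to $R$ is the tuple $(d(u,u^1),\dots,d(u,u^t))$. The set $R$ is a resolving set for $\Gamma$ if distinct vertices of $\Gamma$ have distinct codes with respect to $R$. A resolving set $R_f$ is fault-tolerant if $R_f\setminus\{u\}$ is also a resolving set for every $u\in R_f$. The fault-tolerant metric dimension $\mathrm{fdim}(\Gamma)$ is the minimum cardinality of a fault-tolerant resolving set of $\Gamma$. *)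

(* Defs.v *)
From mathcomp Require Import all_boot.

Set Implicit Arguments.
Unset Strict Implicit.
Unset Printing Implicit Defensive.

(* A simple graph is given by its adjacency relation [e] on a finite type. *)

Section MetricDimension.

Variables (T : finType) (e : rel T).

Definition has_path (u v : T) (k : nat) : bool :=
  [exists p : k.-tuple T, [&& path e u p, last u p == v & uniq (u :: p)]].

(* The least k with a u-v path of length k; the value is #|T| when there is no
   such path, which cannot happen in a connected graph (see distP). *)
Definition dist (u v : T) : nat := find (has_path u v) (iota 0 #|T|).

(* R is ordered by [enum]; the order is irrelevant to injectivity of codes. *)
Definition code (R : {set T}) (u : T) : seq nat := [seq dist u w | w <- enum R].

Definition resolving (R : {set T}) : bool := injectiveb (code R).

Definition ft_resolving (R : {set T}) : bool :=
  resolving R && [forall u in R, resolving (R :\ u)].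

(* The default [set: T] is fault-tolerant resolving whenever the graph is
   connected (see ft_resolving_setT), so this is the minimum. *)
Definition fdim : nat := #|[arg min_(R < [set: T] | ft_resolving R) #|R| ]|.

Lemma has_path_lt u v k : has_path u v k -> k < #|T|.
Proof.
case/existsP=> p /and3P[_ _ /card_uniqP /= sz].
by have := max_card (mem (u :: p)); rewrite sz size_tuple.
Qed.

Lemma connect_has_path u v : connect e u v -> exists k, has_path u v k.
Proof.
case/connectP=> p pth ->; case/shortenP: pth => q pq uq _.
exists (size q); apply/existsP; exists (in_tuple q).
by rewrite pq uq eqxx.
Qed.

Lemma distP u v : connect e u v ->
  has_path u v (dist u v) /\ (forall k, has_path u v k -> dist u v <= k).
Proof.
case/connect_has_path=> k0 Pk0.
have hasP0 : has (has_path u v) (iota 0 #|T|).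
  by apply/hasP; exists k0; rewrite // mem_iota /= add0n (has_path_lt Pk0).
have lt : dist u v < #|T| by move: hasP0; rewrite has_find size_iota.
split=> [|k Pk].
  by have := nth_find 0 hasP0; rewrite nth_iota.
rewrite leqNgt; apply/negP => ltk; have := before_find 0 ltk.
by rewrite nth_iota ?Pk // (has_path_lt Pk).
Qed.

Lemma dist_eq0 u v : connect e u v -> (dist u v == 0) = (u == v).
Proof.
move=> cuv; have [Pd le_d] := distP cuv; apply/eqP/eqP => [d0 | uv].
  by move: Pd; rewrite d0 => /existsP[p /and3P[_]]; rewrite (tuple0 p) => /eqP.
apply/eqP; rewrite -leqn0 le_d //; apply/existsP; exists [tuple].
by rewrite /= uv eqxx.
Qed.

Lemma ft_resolving_setT : (forall u v, connect e u v) -> ft_resolving [set: T].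
Proof.
move=> ce.
have codeE (R : {set T}) u v w : code R u = code R v -> w \in R ->
    dist u w = dist v w.
  by move/eq_in_map => h wR; apply: h; rewrite mem_enum.
have sep (R : {set T}) u v : code R u = code R v -> u \in R -> u = v.
  move=> cE uR; apply/eqP; rewrite eq_sym -(dist_eq0 (ce v u)).
  by rewrite -(codeE _ _ _ _ cE uR) (dist_eq0 (ce u u)).
apply/andP; split; first by apply/injectiveP=> u v /sep; apply; rewrite inE.
apply/forall_inP=> w _; apply/injectiveP=> u v cE.
have [uw|uw] := eqVneq u w; last by apply: sep cE _; rewrite !inE uw.
have [vw|vw] := eqVneq v w; first by rewrite uw vw.
by apply/esym/(sep _ _ _ (esym cE)); rewrite !inE vw.
Qed.

End MetricDimension.

Section DoubleAntiprism.

Variable n : nat.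

(* The vertex j_r^l is (r, l), both indices counted from 0 instead of 1. *)
Definition layer1 : 'I_3 := @Ordinal 3 0 isT.
Definition layer2 : 'I_3 := @Ordinal 3 1 isT.
Definition layer3 : 'I_3 := @Ordinal 3 2 isT.

(* [ordS] is the cyclic successor on 'I_n. *)
Definition antiprism_arc (u v : 'I_3 * 'I_n) : bool :=
  [exists l : 'I_n,
    [|| [exists r : 'I_3, (u, v) == ((r, l), (r, ordS l))],
        (u, v) == ((layer1, l), (layer2, l)),
        (u, v) == ((layer2, l), (layer3, l)),
        (u, v) == ((layer2, l), (layer1, ordS l)) |
        (u, v) == ((layer3, l), (layer2, ordS l)) ]].

Definition double_antiprism : rel ('I_3 * 'I_n) :=
  fun u v => antiprism_arc u v || antiprism_arc v u.

Lemma double_antiprism_sym : symmetric double_antiprism.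
Proof. by move=> u v; rewrite /double_antiprism orbC. Qed.

Lemma double_antiprism_irr : 1 < n -> irreflexive double_antiprism.
Proof.
move=> n1; have neqS (l : 'I_n) : l <> ordS l.
  move/(congr1 val) => /= lS; have := ltn_ord l.
  rewrite leq_eqVlt => /orP[/eqP l1|lt].
    by move: lS n1; rewrite l1 modnn => l0; rewrite -l1 l0.
  by move: lS; rewrite modn_small // => /n_Sn.
move=> u; rewrite /double_antiprism orbb; apply/negbTE/negP.
case/existsP=> l /orP[/existsP[r] /eqP[-> [/neqS]] //|].
by case/or4P=> /eqP[-> []].
Qed.

Lemma double_antiprism_connected u v : connect double_antiprism u v.
Proof.
have csym := sym_connect_sym double_antiprism_sym.
have arc x y : antiprism_arc x y -> connect double_antiprism x y.
  by move=> xy; apply: connect1; rewrite /double_antiprism xy.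
have step r l : connect double_antiprism (r, l) (r, ordS l).
  by apply/arc/existsP; exists l; apply/orP; left; apply/existsP; exists r.
have c12 l : connect double_antiprism (layer1, l) (layer2, l).
  by apply/arc/existsP; exists l; rewrite eqxx !orbT.
have c23 l : connect double_antiprism (layer2, l) (layer3, l).
  by apply/arc/existsP; exists l; rewrite eqxx !orbT.
have down r l : connect double_antiprism (layer1, l) (r, l).
  case: r => [[|[|[|r]]] lt] //.
  - by rewrite (_ : Ordinal lt = layer1) //; apply: val_inj.
  - by rewrite (_ : Ordinal lt = layer2) //; apply: val_inj.
  - rewrite (_ : Ordinal lt = layer3); last exact: val_inj.
    exact: connect_trans (c12 l) (c23 l).
case: u v => [r l] [r' l'].
have n0 : 0 < n by apply: leq_ltn_trans (ltn_ord l).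
have from0 k (lt : k < n) :
    connect double_antiprism (layer1, Ordinal n0) (layer1, Ordinal lt).
  elim: k lt => [|k IH] lt; first by rewrite (bool_irrelevance n0 lt).
  apply: connect_trans (IH (ltnW lt)) _.
  rewrite (_ : Ordinal lt = ordS (Ordinal (ltnW lt))) //.
  by apply: val_inj; rewrite /= modn_small.
have root x y : connect double_antiprism (layer1, Ordinal n0) (x, y).
  by apply: connect_trans (down x y); case: y => k lt; apply: from0.
by rewrite (connect_trans _ (root r' l')) // csym.
Qed.

End DoubleAntiprism.

(* Main.v *)
Require Import Defs.
From mathcomp Require Import all_boot.
From mathcomp Require Import zify.

Set Implicit Arguments.
Unset Strict Implicit.
Unset Printing Implicit Defensive.

(** Lower bound: the neighbours of [a] are all at distance 1 from [a], and
    their distances to [b] lie within 1 of that of [a]; so if [{a, b}] resolves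
    the graph then [a] has at most 3 neighbours. Every vertex of the double
    antiprism has at least 4 neighbours, so no 2-set is resolving and no 3-set
    is fault-tolerant.

    Upper bound: with [k = n./2], the set of the vertices of layer 1 at
    positions [0], [1], [k] and [n - k + 1] (counted from 0) is fault-tolerant.
    Distances to layer 1 have a closed form, which reduces this to linear
    arithmetic. *)

(** * Distances and resolving sets in an arbitrary graph *)

Section Distance.

Variables (T : finType) (e : rel T).

(** [dist] minimises over duplicate-free paths only, so an arbitrary walk is first shortened to
    one. *)
Lemma dist_le_size u p : path e u p -> dist e u (last u p) <= size p.
Proof.
move=> pth; have cuv: connect e u (last u p) by apply/connectP; exists p.
move: cuv; case/shortenP: pth => q pq uq sub cuv.
apply: (@leq_trans (size q)).
  apply: (proj2 (distP cuv)); apply/existsP; exists (in_tuple q).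
  by rewrite pq uq eqxx.
by case/andP: uq => _ /uniq_leq_size; apply.
Qed.

Lemma dist_path u v : connect e u v ->
  exists p, [/\ path e u p, last u p = v & size p = dist e u v].
Proof.
case/distP=> /existsP[p /and3P[pth /eqP lp _]] _.
by exists p; rewrite size_tuple.
Qed.

Lemma dist_step u v w : connect e v w -> e u v -> dist e u w <= (dist e v w).+1.
Proof.
case/dist_path=> p [pth <- <-] euv.
by apply: (@dist_le_size u (v :: p)); rewrite /= euv.
Qed.

(** Following strictly decreasing neighbours from [u] reaches [w] in at most [f u] steps; conversely
    [f] drops by at most 1 along each edge, so no path to [w] is shorter. *)
Lemma dist_unique (w : T) (f : T -> nat) :
    f w = 0 -> (forall u v, e u v -> f u <= (f v).+1) ->
    (forall u, u != w -> exists2 v, e u v & f v < f u) ->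
  forall u, dist e u w = f u.
Proof.
move=> fw lip desc u.
have [p [pth lp sz]]: exists p, [/\ path e u p, last u p = w & size p <= f u].
  have [m] := ubnP (f u); elim: m u => // m IH u /ltnSE le_m.
  have [->|/desc[v euv ltv]] := eqVneq u w; first by exists [::].
  have [p [pth lp sz]] := IH v (leq_trans ltv le_m).
  by exists (v :: p); rewrite /= euv pth lp (leq_ltn_trans sz ltv).
have cuw: connect e u w by apply/connectP; exists p.
apply/eqP; rewrite eqn_leq; apply/andP; split.
  by apply: leq_trans sz; rewrite -lp dist_le_size.
have [q [pq lq <-]] := dist_path cuw.
elim: q u pq lq {p pth lp sz cuw} => [|v q IH] u /=; first by move=> _ ->; rewrite fw.
by case/andP=> /lip fuv pq lq; rewrite (leq_trans fuv) // ltnS IH.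
Qed.

Lemma resolvingP (R : {set T}) :
  reflect (forall u v, {in R, forall w, dist e u w = dist e v w} -> u = v)
          (resolving e R).
Proof.
apply: (iffP (injectiveP _)) => inj u v uv; apply: inj.
  by apply/eq_in_map=> w; rewrite mem_enum; apply: uv.
by move=> w wR; move/eq_in_map: uv; apply; rewrite mem_enum.
Qed.

Lemma resolvingS (R S : {set T}) :
  R \subset S -> resolving e R -> resolving e S.
Proof.
move=> /subsetP sub /resolvingP inj; apply/resolvingP=> u v uv.
by apply: inj => w /sub; apply: uv.
Qed.

Lemma card_le2_subset_pair (x : T) (R : {set T}) :
  #|R| <= 2 -> exists a b, R \subset [set a; b].
Proof.
rewrite leq_eqVlt => /orP[/cards2P[a [b [_ ->]]]|]; first by exists a; exists b.
rewrite ltnS leq_eqVlt => /orP[/cards1P[a ->]|].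
  by exists a; exists a; rewrite setUid.
by rewrite ltnS leqn0 cards_eq0 => /eqP->; exists x; exists x; rewrite sub0set.
Qed.

Hypotheses (esym : symmetric e) (eirr : irreflexive e).
Hypothesis econn : forall u v, connect e u v.

Lemma dist_adj u v : e u v -> dist e u v = 1.
Proof.
move=> euv; apply/eqP; rewrite eqn_leq lt0n dist_eq0 //; apply/andP; split.
  by apply: (@dist_le_size u [:: v]); rewrite /= euv.
by apply: contraTneq euv => ->; rewrite eirr.
Qed.

Lemma resolving_pair_degree a b :
  resolving e [set a; b] -> #|[set x | e a x]| <= 3.
Proof.
(* Distances to [b] separate the neighbours of [a] and lie among the three values starting at
   [(dist e a b).-1]. For [a = b] the predecessor stays at 0, and the values 0, 1, 2 still
   suffice. *)
move=> /resolvingP inj; rewrite cardE -(size_map (dist e ^~ b)).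
rewrite -(size_iota (dist e a b).-1 3); apply: uniq_leq_size.
  rewrite map_inj_in_uniq ?enum_uniq // => x y; rewrite !mem_enum !inE => ax ay xy.
  apply: inj => w; rewrite !inE => /orP[]/eqP-> //.
  by rewrite !dist_adj // esym.
move=> y /mapP[x]; rewrite mem_enum inE => ax ->{y}; rewrite mem_iota.
have := dist_step (econn x b) ax.
by rewrite esym in ax; have := dist_step (econn a b) ax; lia.
Qed.

Lemma ft_resolving_card (x : T) (R : {set T}) :
  (forall a, 4 <= #|[set y | e a y]|) -> ft_resolving e R -> 4 <= #|R|.
Proof.
move=> deg /andP[res /forall_inP ft]; rewrite leqNgt; apply/negP => R3.
have [S resS S2]: exists2 S, resolving e S & #|S| <= 2.
  have [R0|[u uR]] := set_0Vmem R; first by exists R; rewrite // R0 cards0.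
  by exists (R :\ u); [apply: ft | move: R3; rewrite (cardsD1 u) uR].
have [a [b sub]] := card_le2_subset_pair x S2.
have := resolving_pair_degree (resolvingS sub resS).
by rewrite leqNgt deg.
Qed.

End Distance.

(** * Adjacency, distances to layer 1 and degrees in the double antiprism *)

Section Antiprism.

Variable n : nat.
Implicit Types (r s : 'I_3) (l m c : 'I_n).

(** A form of [m = ordS l] without [modulo], suited to linear arithmetic. *)
Definition cyclic_succ (l m : nat) :=
  (m == l.+1) || (l.+1 == n) && (m == 0).

Lemma eq_ordS l m : (m == ordS l) = cyclic_succ l m.
Proof.
rewrite -val_eqE /= /cyclic_succ; have l_n := ltn_ord l; have m_n := ltn_ord m.
have [->|ne] := eqVneq l.+1 n; first by rewrite modnn; lia.
by rewrite modn_small //; lia.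
Qed.

Lemma cyclic_neighbors l :
  exists m p : 'I_n, cyclic_succ l m /\ cyclic_succ p l.
Proof. by exists (ordS l); exists (ord_pred l); rewrite -!eq_ordS ord_predK !eqxx. Qed.

Lemma antiprism_arcE r l s m :
  antiprism_arc (r, l) (s, m) =
  [|| (s == r) && (m == ordS l), (s == r.+1 :> nat) && (m == l)
    | (r == s.+1 :> nat) && (m == ordS l)].
Proof.
apply/existsP/idP => [[k /orP[/existsP[t]|/or4P[]] /eqP[-> -> -> ->]]|].
- by rewrite !eqxx.
- by rewrite eqxx.
- by rewrite eqxx.
- by rewrite eqxx.
- by rewrite eqxx.
have ord3 (i j : 'I_3) : (i == j) = (i == j :> nat) by [].
case/or3P=> /andP[rs /eqP->]; exists l; apply/orP.
- by left; apply/existsP; exists r; rewrite (eqP rs).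
- right; rewrite !xpair_eqE !eqxx !ord3 /=.
  by move: rs (ltn_ord s) (ltn_ord r); case: (val r) => [|[|[|]]] // /eqP->.
- right; rewrite !xpair_eqE !eqxx !ord3 /= !andbT.
  by move: rs (ltn_ord s) (ltn_ord r); case: (val s) => [|[|[|]]] // /eqP->; rewrite ?orbT.
Qed.

Lemma double_antiprismE r l s m :
  double_antiprism (r, l) (s, m) =
  [|| (s == r :> nat) && cyclic_succ l m || (r == s :> nat) && cyclic_succ m l,
      (s == r.+1 :> nat) && (m == l :> nat) || (r == s.+1 :> nat) && (m == l :> nat)
    | (r == s.+1 :> nat) && cyclic_succ l m || (s == r.+1 :> nat) && cyclic_succ m l].
Proof.
rewrite /double_antiprism !antiprism_arcE !eq_ordS -!val_eqE /= (eq_sym (val l)).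
by case: cyclic_succ; case: cyclic_succ; do 5!case: (_ == _).
Qed.

(** The residue of [l - c] modulo [n]: the number of increasing steps from [c] to [l] around the
    cycle. *)
Definition offset (c l : nat) := if c <= l then l - c else l + n - c.

(* Towards increasing positions, the diagonal edges (r+1, l) - (r, l+1) drop
   one layer at no extra cost, whence the [maxn]. *)
Definition dist1 (c r l : nat) :=
  minn (r + offset c l) (maxn r (n - offset c l)).

Lemma offset_cases (c l : nat) : c < n -> l < n ->
  offset c l + c = l \/ offset c l + c = l + n /\ l < c.
Proof. by rewrite /offset; case: (leqP c l); lia. Qed.

Lemma ltn_offset (c l : nat) : c < n -> l < n -> offset c l < n.
Proof. by move=> c_n l_n; have := offset_cases c_n l_n; lia. Qed.

(** Passing to offsets is a rotation of the cycle, so it preserves successors, wrap-around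
    included. *)
Lemma offset_succ (c l m : nat) : c < n -> l < n -> m < n ->
  cyclic_succ l m -> cyclic_succ (offset c l) (offset c m).
Proof.
move=> c_n l_n m_n; rewrite /cyclic_succ.
by case: (offset_cases c_n l_n) => [?|[? ?]]; case: (offset_cases c_n m_n) => [?|[? ?]]; lia.
Qed.

Lemma dist_layer1 c u :
  dist (@double_antiprism n) u (layer1, c) = dist1 c u.1 u.2.
Proof.
have c_n := ltn_ord c.
move: u; apply: dist_unique => [|[r l] [s m]|[r l]].
- by rewrite /dist1 /=; have := offset_cases c_n c_n; lia.
- have l_n := ltn_ord l; have m_n := ltn_ord m.
  have := ltn_offset c_n l_n; have := ltn_offset c_n m_n.
  rewrite double_antiprismE /dist1 /= => y_n x_n.
  have ml : m == l :> nat -> offset c m = offset c l by move/eqP->.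
  have xy := offset_succ c_n l_n m_n; have yx := offset_succ c_n m_n l_n.
  (* Each of the six adjacency cases is rephrased through the two offsets alone, which then become
     variables. *)
  move=> /or3P[]/orP[]/andP[rs lm];
    [move: (xy lm) | move: (yx lm) | move: (ml lm)
    |move: (ml lm) | move: (xy lm) | move: (yx lm)];
    rewrite /cyclic_succ; move: (offset c l) (offset c m) x_n y_n rs {xy yx ml lm} => x y; lia.
rewrite xpair_eqE -!val_eqE => neq.
have r_3 := ltn_ord r; have s_3 : r.-1 < 3 by lia.
(* Only the target itself has both offset and layer index 0. *)
have x0 : offset c l = 0 -> r != 0 :> nat.
  have := offset_cases c_n (ltn_ord l); have := ltn_ord l; move: neq => /=; lia.
have [m [p [lm pl]]] := cyclic_neighbors l; rewrite /dist1.
have lm' := offset_succ c_n (ltn_ord l) (ltn_ord m) lm.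
have pl' := offset_succ c_n (ltn_ord p) (ltn_ord l) pl.
have l_n := ltn_offset c_n (ltn_ord l); have p_n := ltn_offset c_n (ltn_ord p).
(* The descent follows the term attaining the minimum: for the first, drop a layer, or step back to
   [p] within layer 1; for the second, take the diagonal to [m], or in layer 1 (where [r.-1 = r])
   the edge to [m]. *)
have [back|fwd] := leqP (r + offset c l) (maxn r (n - offset c l)).
  have [r0|r0] := posnP r.
    exists (Ordinal s_3, p); first by rewrite double_antiprismE pl /= r0 orbT.
    rewrite /=; move: (offset c l) (offset c p) x0 back pl' l_n p_n {lm'} => x y.
    by rewrite /cyclic_succ; lia.
  exists (Ordinal s_3, l); first by rewrite double_antiprismE /= prednK // !eqxx !orbT.
  by rewrite /=; move: (offset c l) back {x0 lm' pl' l_n p_n} => x; lia.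
exists (Ordinal s_3, m).
  rewrite double_antiprismE lm /= !andbT.
  have [->|r0] := posnP r => //; by rewrite prednK ?eqxx ?orbT.
rewrite /=; move: (offset c l) (offset c m) x0 fwd lm' l_n {pl' p_n} => x z.
by rewrite /cyclic_succ; lia.
Qed.

Lemma double_antiprism_degree (n_ge3 : 3 <= n) a :
  4 <= #|[set x | @double_antiprism n a x]|.
Proof.
case: a => r l; have l_n := ltn_ord l; have r_3 := ltn_ord r.
have [m [p [lm pl]]] := cyclic_neighbors l.
have [ml pl' mp] : [/\ m != l, p != l & m != p].
  have p_n := ltn_ord p; move: lm pl; rewrite /cyclic_succ -!val_eqE /=.
  by split; lia.
(* Besides [m] and [p] in its own layer, the vertex has two neighbours in an adjacent layer: one
   vertical, one diagonal. Diagonals lead from layer 1 back to [p], and from the other layers down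
   to [m]. *)
have [s [q [sr ql adj_l adj_q]]] : exists (s : 'I_3) (q : 'I_n),
    [/\ s != r, q != l, double_antiprism (r, l) (s, l) & double_antiprism (r, l) (s, q)].
  have [r0|r0] := posnP r.
    exists layer2; exists p; split=> //; rewrite ?double_antiprismE ?pl /= ?r0 ?eqxx ?orbT //.
    by rewrite -val_eqE /= r0.
  have s_3 : r.-1 < 3 by lia.
  exists (Ordinal s_3); exists m.
  split=> //; rewrite ?double_antiprismE ?lm /= ?prednK ?eqxx ?orbT //.
  by rewrite -val_eqE /=; lia.
pose t := [:: (r, m); (r, p); (s, l); (s, q)].
rewrite cardE; apply: (@uniq_leq_size _ t).
  rewrite /= !inE !xpair_eqE ![r == s]eq_sym (negbTE sr) ![l == q]eq_sym (negbTE ql).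
  by rewrite (negbTE mp) !andbF.
move=> x; rewrite mem_enum !inE => /or4P[]/eqP-> //; rewrite double_antiprismE.
  by rewrite lm eqxx.
by rewrite pl eqxx orbT.
Qed.

(** Unfolds the minimum, the maximum and the wrap-around into linear cases; [x] is the offset. *)
Lemma dist1_cases (c r l : nat) : l < n -> c < n ->
  exists x, (x + c = l \/ x + c = l + n /\ l < c) /\
    (2 * x + r <= n /\ dist1 c r l = r + x \/
     n < 2 * x + r /\ (r + x <= n /\ dist1 c r l + x = n \/
                      n < r + x /\ dist1 c r l = r)).
Proof.
move=> l_n c_n; exists (offset c l); have := offset_cases c_n l_n.
by rewrite /dist1; lia.
Qed.

End Antiprism.

(** * The four landmarks and the upper bound *)

Ltac split_dist1 n c r l l_n :=
  let H := fresh in have H : c < n by [lia];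
  destruct (@dist1_cases n c r l l_n H)
    as [? [[?|[? ?]] [[? ?]|[? [[? ?]|[? ?]]]]]];
  (* Contradictory cases are discarded at once, which limits the growth under successive splits. *)
  clear H; generalize dependent (dist1 n c r l); intros; try (exfalso; lia).

(** The pairs [0], [k] and [1], [(n - k).+1] are both at cyclic distance [k], the largest possible.
    At most the landmark [i] is lost, and any three of the four equations already force equality by
    case analysis. *)
Lemma landmarks_resolve n k r l s m i :
    6 <= n -> k.*2 <= n <= k.*2.+1 -> r < 3 -> l < n -> s < 3 -> m < n ->
    {in [:: 0; 1; k; (n - k).+1], forall c,
       c != i -> dist1 n c r l = dist1 n c s m} ->
  r = s /\ l = m.
Proof.
move=> n_ge6 nk r3 l_n s3 m_n E.
have {E} [E0 E1 Ek Eq] : [/\ 0 != i -> dist1 n 0 r l = dist1 n 0 s m,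
    1 != i -> dist1 n 1 r l = dist1 n 1 s m,
    k != i -> dist1 n k r l = dist1 n k s m &
    (n - k).+1 != i -> dist1 n (n - k).+1 r l = dist1 n (n - k).+1 s m].
  by split; apply: E; rewrite !inE eqxx ?orbT.
have [i0|/E0{}E0] := eqVneq 0 i.
  have {}E1 := E1 ltac:(lia); have {}Ek := Ek ltac:(lia); have {}Eq := Eq ltac:(lia).
  clear E0; split_dist1 n 1 r l l_n; split_dist1 n k r l l_n;
    split_dist1 n (n - k).+1 r l l_n; split_dist1 n 1 s m m_n;
    split_dist1 n k s m m_n; split_dist1 n (n - k).+1 s m m_n; lia.
have [i1|/E1{}E1] := eqVneq 1 i.
  have {}Ek := Ek ltac:(lia); have {}Eq := Eq ltac:(lia).
  clear E1; split_dist1 n 0 r l l_n; split_dist1 n k r l l_n;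
    split_dist1 n (n - k).+1 r l l_n; split_dist1 n 0 s m m_n;
    split_dist1 n k s m m_n; split_dist1 n (n - k).+1 s m m_n; lia.
have [ik|/Ek{}Ek] := eqVneq k i.
  have {}Eq := Eq ltac:(lia).
  clear Ek; split_dist1 n 0 r l l_n; split_dist1 n 1 r l l_n;
    split_dist1 n (n - k).+1 r l l_n; split_dist1 n 0 s m m_n;
    split_dist1 n 1 s m m_n; split_dist1 n (n - k).+1 s m m_n; lia.
(* Here [i] is none of [0], [1], [k], and these three decide. *)
clear Eq; split_dist1 n 0 r l l_n; split_dist1 n 1 r l l_n;
  split_dist1 n k r l l_n; split_dist1 n 0 s m m_n;
  split_dist1 n 1 s m m_n; split_dist1 n k s m m_n; lia.
Qed.

Theorem theorem0p1 (n : nat) (n_ge6 : 6 <= n) : fdim (@double_antiprism n) = 4.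
Proof.
have n_gt0 : 0 < n by lia.
have conn := @double_antiprism_connected n.
rewrite /fdim; case: arg_minnP => [|R ftR minR]; first exact: ft_resolving_setT.
apply/eqP; rewrite eqn_leq; apply/andP; split; last first.
  apply: ft_resolving_card ftR => //.
  - exact: double_antiprism_sym.
  - by apply: double_antiprism_irr; lia.
  - exact: (layer1, Ordinal n_gt0).
  - by apply: double_antiprism_degree; lia.
pose landmarks := [:: 0; 1; n./2; (n - n./2).+1].
pose S := [set (layer1, c) | c : 'I_n & val c \in landmarks].
(* Serves both halves of fault tolerance: [i := n] is the position of no vertex and gives [S]
   itself, while a position [i] gives [S] without that vertex. *)
have all_but_one (i : nat) (Q : {set 'I_3 * 'I_n}) :
    (forall c : 'I_n, val c \in landmarks -> val c != i -> (layer1, c) \in Q) ->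
  resolving (@double_antiprism n) Q.
  move=> inQ; apply/resolvingP=> -[r l] [s m] E.
  have [||||||c c_lm c_i|/val_inj-> /val_inj->] //=
    := @landmarks_resolve n n./2 r l s m i; first lia.
  have c_n : c < n by move: c_lm; rewrite !inE; lia.
  by have := E _ (inQ (Ordinal c_n) c_lm c_i); rewrite !dist_layer1.
apply: (leq_trans (minR S _)).
  apply/andP; split; first by apply: (all_but_one n) => c c_lm _; apply: imset_f; rewrite inE.
  apply/forall_inP=> _ /imsetP[i _ ->]; apply: (all_but_one i) => c c_lm c_i.
  by rewrite !inE xpair_eqE -[c == i]val_eqE /= c_i; apply: imset_f; rewrite inE.
(* The positions used form a duplicate-free list contained in the four-entry list [landmarks]. *)
apply: leq_trans (leq_imset_card _ _) _; rewrite cardE -(size_map val).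
apply: (@uniq_leq_size _ _ landmarks); first by rewrite (map_inj_uniq val_inj) enum_uniq.
by move=> _ /mapP[c + ->]; rewrite mem_enum inE.
Qed.
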